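(* Let $h,k,\mu$ be pairwise relatively prime positive integers with $h,k\ge 2$, and let $\alpha,\beta$ be positive integers with $(\alpha,h)=(\beta,k)=1$. Then $$4hk\mu\Big(S_{\alpha,\beta}(h,k\mid\mu)+S_{\beta,\alpha}(k,h\mid\mu)\Big)=\mu^2\csc^2\!\left(\mu\Big(\frac{\alpha}{h}+\frac{\beta}{k}\Big)\pi\right)-hk\mu-hk\sum_{j=1}^{\mu}\cot\!\left(k\Big(\frac{j}{\mu}+\frac{\alpha}{h}\Big)\pi\right)\cot\!\left(h\Big(\frac{j}{\mu}+\frac{\beta}{k}\Big)\pi\right).$$
   Context: For positive integers $\mu$, $h,k$ and integers $\alpha,\beta$, define $$S_{\alpha,\beta}(h,k\mid\mu)=\frac{1}{4k}\sum_{j=1}^{k-1}\cot\!\left(\mu\Big(\frac jk+\frac{\alpha}{h}+\frac{\beta}{k}\Big)\pi\right)\cot\!\left(\frac{jh}{k}\pi\right).$$ Thus $S_{\beta,\alpha}(k,h\mid\mu)=\frac{1}{4h}\sum_{j=1}^{h-1}\cot\!\left(\mu\big(\frac jh+\frac{\beta}{k}+\frac{\alpha}{h}\big)\pi\right)\cot\!\left(\frac{jk}{h}\pi\right)$. *)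

(* Defs.v *)
From mathcomp Require Import all_boot all_order all_algebra.
From mathcomp Require Import all_classical all_reals all_analysis.

Set Implicit Arguments.
Unset Strict Implicit.
Unset Printing Implicit Defensive.

Import Order.TTheory GRing.Theory Num.Theory.

Local Open Scope ring_scope.

(* Since [0^-1 = 0], these take the value 0 at the poles. *)
Definition cot (R : realType) (x : R) : R := cos x / sin x.

Definition csc (R : realType) (x : R) : R := (sin x)^-1.

(* S_{alpha,beta}(h, k | mu) *)
Definition cotS (R : realType) (alpha beta : int) (h k mu : nat) : R :=
  (4 * k%:R)^-1 *
  \sum_(1 <= j < k)
     cot (mu%:R * (j%:R / k%:R + alpha%:~R / h%:R + beta%:~R / k%:R) * pi)
     * cot (j%:R * h%:R / k%:R * pi).

(* Main.v *)
(** Put [w = alpha/h + beta/k]. The multiplication formula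
    [n cot (n x) = \sum_(j < n) cot (x + j pi / n)] expands every cotangent of
    the three sums, so that they become triple sums over [a < mu], [j < k],
    [i < h] of the products of two of [cot (B - A)], [cot (C - A)],
    [cot (B - C)] with [A = - a pi / mu], [B = pi (w + j / k)],
    [C = pi (w + i / h)]. Whenever no pole occurs,
    [cot (B - A) cot (C - A) + cot (B - A) cot (B - C) - cot (C - A) cot (B - C)
     = -1]; the only pole is [j = i = 0], where [cot 0 = 0] leaves
    [\sum_a cot (w pi + a pi / mu) ^ 2 = mu^2 csc (mu w pi) ^ 2 - mu]. *)

Require Import Defs.
From mathcomp Require Import all_boot all_order all_algebra.
From mathcomp Require Import all_classical all_reals all_analysis.
From mathcomp Require Import ring lra.

Import Order.TTheory GRing.Theory Num.Theory.

Local Open Scope ring_scope.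

Section Cotangent.
Context {R : realType}.
Implicit Types (x y : R) (m n p q : nat).

(** * Period of the cotangent and zeros of the sine at rational multiples of [pi] *)

Lemma sinD_natpi x n : sin (x + n%:R * pi) = (-1) ^+ n * sin x.
Proof.
elim: n => [|n IHn]; first by rewrite mul0r addr0 expr0 mul1r.
have -> : x + n.+1%:R * pi = x + n%:R * pi + pi by rewrite -natr1; ring.
by rewrite sinDpi IHn exprS; ring.
Qed.

Lemma cosD_natpi x n : cos (x + n%:R * pi) = (-1) ^+ n * cos x.
Proof.
elim: n => [|n IHn]; first by rewrite mul0r addr0 expr0 mul1r.
have -> : x + n.+1%:R * pi = x + n%:R * pi + pi by rewrite -natr1; ring.
by rewrite cosDpi IHn exprS; ring.
Qed.

Lemma cotD_natpi x n : cot (x + n%:R * pi) = cot x.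
Proof.
by rewrite /cot sinD_natpi cosD_natpi -mulf_div divff ?mul1r ?signr_eq0.
Qed.

Lemma cotN x : cot (- x) = - cot x.
Proof. by rewrite /cot sinN cosN invrN mulrN. Qed.

Lemma cot0 : cot (0 : R) = 0.
Proof. by rewrite /cot sin0 invr0 mulr0. Qed.

(** Reducing [p] modulo [q] changes the sine only by a sign, and the sine is positive strictly
    between 0 and [pi], so a zero forces [q %| p]. The divisor [d] lets later uses test a single
    factor of the denominator. *)
Lemma sin_ratpi_neq0 p q d : (0 < q)%N -> (d %| q)%N -> ~~ (d %| p)%N ->
  sin (p%:R / q%:R * pi : R) != 0.
Proof.
move=> q_gt0 dvd_dq; apply: contraNneq => sin0.
have q_neq0 : q%:R != 0 :> R by rewrite pnatr_eq0 -lt0n.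
apply: (dvdn_trans dvd_dq); rewrite /dvdn; apply/negPn/negP => r_neq0.
have : sin ((p %% q)%:R / q%:R * pi : R) = 0.
  apply/eqP; move/eqP: sin0; rewrite {1}(divn_eq p q) natrD natrM.
  have -> : ((p %/ q)%:R * q%:R + (p %% q)%:R) / q%:R * pi
     = (p %% q)%:R / q%:R * pi + (p %/ q)%:R * pi :> R by field.
  by rewrite sinD_natpi mulf_eq0 signr_eq0.
apply/eqP; rewrite gt_eqF // sin_gt0_pi //.
have pi0 := pi_gt0 R; apply/andP; split.
  by rewrite mulr_gt0 // divr_gt0 ?ltr0n // lt0n.
by rewrite gtr_pMl // ltr_pdivrMr ?ltr0n // mul1r ltr_nat ltn_pmod.
Qed.

Lemma sin_natmul_eq0 n x : sin x = 0 -> sin (n%:R * x) = 0.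
Proof.
move=> sx0; elim: n => [|n IHn]; first by rewrite mul0r sin0.
by rewrite -natr1 mulrDl mul1r sinD sx0 IHn mulr0 mul0r addr0.
Qed.

Lemma sinD_ratpi_neq0 n j x : (0 < n)%N -> sin (n%:R * x) != 0 ->
  sin (x + j%:R / n%:R * pi) != 0.
Proof.
move=> n_gt0; apply: contra_neq => /(sin_natmul_eq0 n).
have n_neq0 : n%:R != 0 :> R by rewrite pnatr_eq0 -lt0n.
have -> : n%:R * (x + j%:R / n%:R * pi) = n%:R * x + j%:R * pi by field.
by rewrite sinD_natpi => /eqP; rewrite mulf_eq0 signr_eq0 => /eqP.
Qed.

(** This is the subtraction formula for [cot (x - y)] with its denominator cleared. *)
Lemma cotM x y : sin x != 0 -> sin y != 0 -> sin (x - y) != 0 ->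
  cot x * cot y = cot (x - y) * (cot y - cot x) - 1.
Proof.
rewrite /cot sinB cosB => sx sy sxy; field.
by rewrite sx sy sxy.
Qed.

(** * Cotangent sums over a full period, poles included *)

Lemma sum_cot_shift n m : (0 < n)%N ->
  \sum_(j < n) cot ((m + j)%:R / n%:R * pi : R)
  = \sum_(j < n) cot (j%:R / n%:R * pi : R).
Proof.
case: n => // n _; elim: m => // m <-.
rewrite big_ord_recr big_ord_recl /= addrC; congr (_ + _).
  rewrite -[RHS](cotD_natpi _ 1); congr cot.
  have n_neq0 : n.+1%:R != 0 :> R by rewrite pnatr_eq0.
  by rewrite addn0 addSnnS natrD; move: _%:R n_neq0 => N N_neq0; field.
by apply: eq_bigr => i _; rewrite addSnnS.
Qed.

(** For every [m] the sum equals the full-period sum of [cot (j pi / n)]. At [m = 0] oddness also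
    makes it the opposite of that sum, so both vanish. *)
Lemma sum_cotB_ratpi n m : (0 < n)%N ->
  \sum_(j < n) cot (m%:R / n%:R * pi - j%:R / n%:R * pi : R) = 0.
Proof.
move=> n_gt0.
have n_neq0 : n%:R != 0 :> R by rewrite pnatr_eq0 -lt0n.
have shift l : \sum_(j < n) cot (l%:R / n%:R * pi - j%:R / n%:R * pi : R)
    = \sum_(j < n) cot (j%:R / n%:R * pi : R).
  (* Replacing [j] by [n - 1 - j] and adding one period turns [l - j] into [l + 1 + j], hence the
     shift by [l.+1]. *)
  rewrite -(sum_cot_shift n l.+1) // (reindex_inj rev_ord_inj) /=.
  apply: eq_bigr => j _; rewrite -[LHS](cotD_natpi _ 1); congr cot.
  by rewrite natrB // natrD -!natr1; field.
rewrite shift; have := shift 0%N.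
under eq_bigr do rewrite mul0r mul0r sub0r cotN.
by rewrite sumrN; lra.
Qed.

(** * The multiplication formula for the cotangent *)

(* The real and imaginary parts of [('X + i) ^+ n]: since
   [cot x + i = e ^ (i x) / sin x], their values at [cot x] are
   [cos (n x) / sin x ^ n] and [sin (n x) / sin x ^ n]. *)
Fixpoint powXi n : {poly R} * {poly R} :=
  if n is m.+1 then let: (p, q) := powXi m in ('X * p - q, 'X * q + p)
  else (1, 0).

Lemma powXi_cot n x : sin x != 0 ->
  (powXi n).1.[cot x] * sin x ^+ n = cos (n%:R * x) /\
  (powXi n).2.[cot x] * sin x ^+ n = sin (n%:R * x).
Proof.
move=> sx; elim: n => [|n] /=; first by rewrite mul0r sin0 cos0 !hornerE.
case: (powXi n) => p q /= [IHp IHq].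
have -> : n.+1%:R * x = n%:R * x + x by rewrite -natr1; ring.
rewrite cosD sinD -IHp -IHq !hornerE exprS /cot.
by split; field.
Qed.

(** These are the top coefficients that Vieta's formula needs. The factor ['X] gives access to the
    coefficient of index [n - 1] and yields 0 when [n = 0]. *)
Lemma powXi_coef n :
  [/\ (powXi n).1`_n = 1, ('X * (powXi n).1)`_n = 0,
      ('X * (powXi n).2)`_n = n%:R,
      (forall i, (n < i)%N -> (powXi n).1`_i = 0) &
      (forall i, (n <= i)%N -> (powXi n).2`_i = 0)].
Proof.
elim: n => [|n] /=.
  split; rewrite ?mulr0 ?mulr1 ?coef1 ?coefX ?coef0 //.
    by case=> // i; rewrite coef1.
  by move=> i _; rewrite coef0.
case: (powXi n) => p q /= [p1 p2 q1 p3 q3]; split.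
- by rewrite coefB coefXM /= p1 q3 // subr0.
- by rewrite coefXM /= coefB p2 q3 // subr0.
- by rewrite coefXM /= coefD q1 p1 natr1.
- case=> // i lt_ni; rewrite coefB coefXM /= p3 // q3 ?subr0 //.
  exact: ltnW (ltnW lt_ni).
- case=> // i le_ni; rewrite coefD coefXM /= q3 // p3 ?addr0 //.
Qed.

(** The [n] summands are distinct roots of a monic polynomial [F] of degree [n], so their sum is the
    opposite of its coefficient of index [n - 1]. *)
Lemma sum_cotD n x : (0 < n)%N -> sin (n%:R * x) != 0 ->
  \sum_(j < n) cot (x + j%:R / n%:R * pi) = n%:R * cot (n%:R * x).
Proof.
case: n => // n _ snx.
set t := fun j : nat => cot (x + j%:R / n.+1%:R * pi).
set c := cot _; set F := (powXi n.+1).1 - c *: (powXi n.+1).2.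
have [p1 p2 q1 p3 q3] := powXi_coef n.+1.
have coefF1 : F`_n.+1 = 1 by rewrite coefB coefZ p1 q3 // mulr0 subr0.
have coefF0 : F`_n = - (c * n.+1%:R).
  by move: p2 q1; rewrite !coefXM /= coefB coefZ => -> ->; rewrite sub0r.
have sizeF : size F = n.+2.
  apply/eqP; rewrite eqn_leq; apply/andP; split.
    apply/leq_sizeP => i lt_ni; rewrite coefB coefZ p3 // q3 ?mulr0 ?subr0 //.
    exact: ltnW.
  by rewrite ltnNge; apply/negP => /leq_sizeP/(_ _ (leqnn _))/eqP; rewrite coefF1 oner_eq0.
have n_neq0 : n.+1%:R != 0 :> R by rewrite pnatr_eq0.
have st j : sin (x + j%:R / n.+1%:R * pi) != 0 by apply: sinD_ratpi_neq0.
pose ts := [seq t j | j <- iota 0 n.+1].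
have rootF : all (root F) ts.
  apply/allP => _ /mapP[j _ ->]; apply/rootP.
  (* With [y = x + j pi / n], the value of [F] times [sin y ^ n] is [cos (n y) - c sin (n y)]. It
     vanishes because [n y] differs from [n x] by a multiple of [pi]. *)
  have [ct ct'] := powXi_cot n.+1 _ (st j).
  have/mulIf := expf_neq0 n.+1 (st j); apply.
  rewrite mul0r hornerD hornerN hornerZ mulrBl -(mulrA c) ct ct'.
  have -> : n.+1%:R * (x + j%:R / n.+1%:R * pi) = n.+1%:R * x + j%:R * pi by field.
  by rewrite sinD_natpi cosD_natpi /c /cot; field.
have uniqt : uniq_roots ts.
  rewrite uniq_rootsE map_inj_in_uniq ?iota_uniq // => i j.
  (* Equal cotangents would make the sine of the difference of the arguments vanish, yet that
     difference lies strictly between 0 and [pi]. *)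
  have lt_t a b : (a < b)%N -> (b < n.+1)%N -> t a <> t b.
    move=> lt_ab lt_bn; rewrite /t /cot => /eqP.
    rewrite eqr_div // => /eqP E.
    have: sin ((b - a)%:R / n.+1%:R * pi : R) != 0.
      apply: (sin_ratpi_neq0 _ _ n.+1) => //.
      by rewrite gtnNdvd ?subn_gt0 // (leq_ltn_trans (leq_subr _ _)).
    have -> : (b - a)%:R / n.+1%:R * pi
      = (x + b%:R / n.+1%:R * pi) - (x + a%:R / n.+1%:R * pi) :> R.
      by rewrite natrB ?(ltnW lt_ab) //; field.
    by rewrite sinB mulrC E mulrC subrr eqxx.
  rewrite !mem_iota /= !add0n => lin ljn tij.
  by case: (ltngtP i j) => // /lt_t; [move/(_ ljn) | move/(_ lin)]; rewrite tij.
have sizets : size ts = n.+1 by rewrite size_map size_iota.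
have sizeFts : size F = (size ts).+1 by rewrite sizets.
have := all_roots_prod_XsubC sizeFts rootF uniqt.
rewrite lead_coefE sizeF /= coefF1 scale1r => FE.
have := @coefPn_prod_XsubC _ ts; rewrite sizets -FE /= coefF0 => /(_ isT) /oppr_inj.
rewrite mulrC => ->; rewrite big_map.
by rewrite -[iota 0 n.+1]/(index_iota 0 n.+1) big_mkord.
Qed.

(* With the convention [cot 0 = 0] the formula survives at [x = 0]. *)
Lemma sum_cotB n x : (0 < n)%N -> (x != 0 -> sin (n%:R * x) != 0) ->
  \sum_(j < n) cot (x - j%:R / n%:R * pi) = n%:R * cot (n%:R * x).
Proof.
move=> n_gt0; have [-> _|x0 /(_ isT) snx] := eqVneq x 0.
  rewrite mulr0 cot0 mulr0 -[RHS](sum_cotB_ratpi n 0) //.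
  by apply: eq_bigr => j _; rewrite !mul0r.
have := sum_cotD n (- x) n_gt0.
rewrite mulrN sinN oppr_eq0 cotN mulrN => /(_ snx)/(congr1 -%R).
by rewrite opprK -sumrN => <-; apply: eq_bigr => j _; rewrite -cotN opprD opprK.
Qed.

(** Square the sum given by [sum_cotD]. By [cotM] the off-diagonal products become linear in the
    [t i], with coefficients [d i j] whose row and column sums vanish. Only the constants -1 and the
    diagonal survive. *)
Lemma sum_cot_sqr n x : (0 < n)%N -> sin (n%:R * x) != 0 ->
  \sum_(j < n) cot (x + j%:R / n%:R * pi) ^+ 2
  = n%:R ^+ 2 * csc (n%:R * x) ^+ 2 - n%:R.
Proof.
move=> n_gt0 snx.
have n_neq0 : n%:R != 0 :> R by rewrite pnatr_eq0 -lt0n.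
pose t (j : 'I_n) := cot (x + j%:R / n%:R * pi).
pose d (i j : 'I_n) := cot (i%:R / n%:R * pi - j%:R / n%:R * pi : R).
have tt i j : t i * t j = d i j * t j - d i j * t i - 1 + (i == j)%:R * (1 + t i ^+ 2).
  have [->|neq_ij] := eqVneq i j.
    by rewrite subrr mul1r; ring.
  rewrite mul0r addr0 -mulrBr /t cotM ?sinD_ratpi_neq0 //.
    by congr (cot _ * _ - _); ring.
  have sin_lt (a b : 'I_n) : (a < b)%N ->
     sin (b%:R / n%:R * pi - a%:R / n%:R * pi : R) != 0.
    move=> lt_ab; have -> : b%:R / n%:R * pi - a%:R / n%:R * pi
       = (b - a)%:R / n%:R * pi :> R by rewrite natrB ?(ltnW lt_ab) //; field.
    apply: (sin_ratpi_neq0 _ _ n) => //.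
    by rewrite gtnNdvd ?subn_gt0 // (leq_ltn_trans (leq_subr _ _)).
  rewrite opprD addrACA subrr add0r.
  case: (ltngtP i j) => [lt_ij|lt_ji|/val_inj/eqP]; last by rewrite (negPf neq_ij).
    by rewrite -opprB sinN oppr_eq0 sin_lt.
  exact: sin_lt.
have dl i : \sum_j d i j = 0 by apply: sum_cotB_ratpi.
have dr j : \sum_i d i j = 0.
  transitivity (- \sum_i d j i); last by rewrite dl oppr0.
  by rewrite -sumrN; apply: eq_bigr => i _; rewrite /d -cotN opprB.
have diag i : \sum_j (i == j)%:R * (1 + t i ^+ 2) = 1 + t i ^+ 2.
  rewrite (bigD1 i) //= eqxx mul1r big1 ?addr0 // => j.
  by rewrite eq_sym => /negPf ->; rewrite mul0r.
have : (\sum_i t i) * (\sum_j t j) = \sum_i t i ^+ 2 + n%:R - n%:R ^+ 2.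
  rewrite mulr_suml.
  under eq_bigr => i _ do rewrite mulr_sumr.
  under eq_bigr => i _.
    under eq_bigr => j _ do rewrite tt.
    rewrite !big_split /= !sumrN -mulr_suml dl mul0r subr0 sumr_const card_ord.
    rewrite diag; over.
  rewrite !big_split /= exchange_big /=.
  under [X in X + _ + _]eq_bigr => j _ do rewrite -mulr_suml dr mul0r.
  by rewrite big1 // sumrN !sumr_const card_ord -mulrnA natrM; ring.
rewrite sum_cotD // => E.
have -> : csc (n%:R * x) ^+ 2 = 1 + cot (n%:R * x) ^+ 2.
  rewrite /csc /cot; have := cos2sin2 (n%:R * x) => c2.
  by rewrite expr_div_n c2; field.
by rewrite -/(t _) in E *; lra.
Qed.

End Cotangent.

(** * Reciprocity from two evaluations of one triple sum *)

Theorem mainTheorem11 (R : realType) (h k mu alpha beta : nat)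
    (h_ge2 : (2 <= h)%N) (k_ge2 : (2 <= k)%N) (mu_gt0 : (0 < mu)%N)
    (cop_hk : coprime h k) (cop_hmu : coprime h mu) (cop_kmu : coprime k mu)
    (alpha_gt0 : (0 < alpha)%N) (beta_gt0 : (0 < beta)%N)
    (cop_alphah : coprime alpha h) (cop_betak : coprime beta k) :
  4 * h%:R * k%:R * mu%:R
    * (cotS R alpha%:Z beta%:Z h k mu + cotS R beta%:Z alpha%:Z k h mu)
  = mu%:R ^+ 2 * csc (mu%:R * (alpha%:R / h%:R + beta%:R / k%:R) * pi : R) ^+ 2
    - h%:R * k%:R * mu%:R
    - h%:R * k%:R *
      \sum_(1 <= j < mu.+1)
         cot (k%:R * (j%:R / mu%:R + alpha%:R / h%:R) * pi : R)
         * cot (h%:R * (j%:R / mu%:R + beta%:R / k%:R) * pi : R).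
Proof.
have h_gt0 : (0 < h)%N by apply: ltnW.
have k_gt0 : (0 < k)%N by apply: ltnW.
have cop_kh : coprime k h by rewrite coprime_sym.
have h_neq0 : h%:R != 0 :> R by rewrite pnatr_eq0 -lt0n.
have k_neq0 : k%:R != 0 :> R by rewrite pnatr_eq0 -lt0n.
have mu_neq0 : mu%:R != 0 :> R by rewrite pnatr_eq0 -lt0n.
pose w : R := (alpha%:R / h%:R + beta%:R / k%:R) * pi.
pose f a : R := cot (k%:R * (w + a%:R / mu%:R * pi)).
pose g a : R := cot (h%:R * (w + a%:R / mu%:R * pi)).
pose u j : R := cot (mu%:R * (w + j%:R / k%:R * pi)).
pose v i : R := cot (mu%:R * (w + i%:R / h%:R * pi)).
(* The index 0 can be added to the range because its second factor is [cot 0 = 0]. *)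
have -> : cotS R alpha%:Z beta%:Z h k mu
    = (4 * k%:R)^-1 * \sum_(j < k) u j * cot (h%:R * (j%:R / k%:R * pi)).
  rewrite /cotS; congr (_ * _).
  rewrite -(big_mkord predT (fun j => u j * cot (h%:R * (j%:R / k%:R * pi)))).
  rewrite [RHS]big_ltn // !(mul0r, mulr0) cot0 mulr0 add0r.
  apply: eq_bigr => j _; congr (cot _ * cot _); last by ring.
  by rewrite /w -!pmulrn; ring.
have -> : cotS R beta%:Z alpha%:Z k h mu
    = (4 * h%:R)^-1 * \sum_(i < h) v i * cot (k%:R * (i%:R / h%:R * pi)).
  rewrite /cotS; congr (_ * _).
  rewrite -(big_mkord predT (fun i => v i * cot (k%:R * (i%:R / h%:R * pi)))).
  rewrite [RHS]big_ltn // !(mul0r, mulr0) cot0 mulr0 add0r.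
  apply: eq_bigr => j _; congr (cot _ * cot _); last by ring.
  by rewrite /w -!pmulrn; ring.
(* Adding [beta pi] to the first argument and [alpha pi] to the second brings in [w]. The index [mu]
   then wraps around to 0, by shifts of [k pi] and [h pi]. *)
have -> : \sum_(1 <= j < mu.+1)
         cot (k%:R * (j%:R / mu%:R + alpha%:R / h%:R) * pi : R)
         * cot (h%:R * (j%:R / mu%:R + beta%:R / k%:R) * pi : R)
    = \sum_(a < mu) f a * g a.
  transitivity (\sum_(1 <= j < mu.+1) f j * g j).
    apply: eq_bigr => j _; congr (_ * _).
      rewrite -[LHS](cotD_natpi _ beta) /f /w; congr cot; field.
      by rewrite h_neq0 mu_neq0 k_neq0.
    rewrite -[LHS](cotD_natpi _ alpha) /g /w; congr cot; field.
    by rewrite h_neq0 mu_neq0 k_neq0.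
  rewrite -(big_mkord predT (fun a => f a * g a)) big_nat_recr //=.
  rewrite [RHS]big_ltn // addrC; congr (_ * _ + _).
    rewrite -[RHS](cotD_natpi _ k) /f; congr cot; field.
    by rewrite mu_neq0.
  rewrite -[RHS](cotD_natpi _ h) /g; congr cot; field.
  by rewrite mu_neq0.
have -> : mu%:R * (alpha%:R / h%:R + beta%:R / k%:R) * pi = mu%:R * w by rewrite mulrA.
(* To exclude poles, each numerator below is written as a multiple of [h] plus [m * alpha], or a
   multiple of [k] plus [m * beta], with [m] coprime to that modulus. *)
have ndvd p m : (h %| p)%N -> coprime h m -> ~~ (h %| p + m * alpha)%N.
  move=> dvd_p cop_m; rewrite dvdn_addr // Gauss_dvdr //.
  apply: contraTN cop_alphah => dvd_a.
  by rewrite /coprime (gcdn_idPr dvd_a) gtn_eqF.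
have ndvd' p m : (k %| p)%N -> coprime k m -> ~~ (k %| p + m * beta)%N.
  move=> dvd_p cop_m; rewrite dvdn_addr // Gauss_dvdr //.
  apply: contraTN cop_betak => dvd_a.
  by rewrite /coprime (gcdn_idPr dvd_a) gtn_eqF.
have sin_mu j : sin (mu%:R * (w + j%:R / k%:R * pi)) != 0.
  have -> : mu%:R * (w + j%:R / k%:R * pi)
    = (h * (mu * (beta + j)) + (mu * k) * alpha)%:R / (h * k)%:R * pi.
    by rewrite !(natrD, natrM) /w; field; rewrite h_neq0 k_neq0.
  apply: (sin_ratpi_neq0 _ _ h); rewrite ?muln_gt0 ?h_gt0 ?dvdn_mulr //.
  by rewrite ndvd ?dvdn_mulr // coprimeMr cop_hmu.
have sin_mu' i : sin (mu%:R * (w + i%:R / h%:R * pi)) != 0.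
  have -> : mu%:R * (w + i%:R / h%:R * pi)
    = (k * (mu * (alpha + i)) + (mu * h) * beta)%:R / (h * k)%:R * pi.
    by rewrite !(natrD, natrM) /w; field; rewrite h_neq0 k_neq0.
  apply: (sin_ratpi_neq0 _ _ k); rewrite ?muln_gt0 ?h_gt0 ?dvdn_mull //.
  by rewrite ndvd' ?dvdn_mulr // coprimeMr cop_kmu.
have sin_k a : sin (k%:R * (w + a%:R / mu%:R * pi)) != 0.
  have -> : k%:R * (w + a%:R / mu%:R * pi)
    = (h * (mu * beta + k * a) + (mu * k) * alpha)%:R / (h * mu)%:R * pi.
    by rewrite !(natrD, natrM) /w; field; rewrite h_neq0 k_neq0 mu_neq0.
  apply: (sin_ratpi_neq0 _ _ h); rewrite ?muln_gt0 ?h_gt0 ?dvdn_mulr //.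
  by rewrite ndvd ?dvdn_mulr // coprimeMr cop_hmu.
have sin_h a : sin (h%:R * (w + a%:R / mu%:R * pi)) != 0.
  have -> : h%:R * (w + a%:R / mu%:R * pi)
    = (k * (mu * alpha + h * a) + (mu * h) * beta)%:R / (k * mu)%:R * pi.
    by rewrite !(natrD, natrM) /w; field; rewrite h_neq0 k_neq0 mu_neq0.
  apply: (sin_ratpi_neq0 _ _ k); rewrite ?muln_gt0 ?k_gt0 ?dvdn_mulr //.
  by rewrite ndvd' ?dvdn_mulr // coprimeMr cop_kmu.
pose x (a : 'I_mu) (j : 'I_k) : R := cot (w + a%:R / mu%:R * pi + j%:R / k%:R * pi).
pose y (a : 'I_mu) (i : 'I_h) : R := cot (w + a%:R / mu%:R * pi + i%:R / h%:R * pi).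
pose z (j : 'I_k) (i : 'I_h) : R := cot (j%:R / k%:R * pi - i%:R / h%:R * pi).
pose O : 'I_k := Ordinal k_gt0; pose O' : 'I_h := Ordinal h_gt0.
have xyz a j i : x a j * y a i + x a j * z j i - y a i * z j i
    = ((j == O) && (i == O'))%:R * (1 + cot (w + a%:R / mu%:R * pi) ^+ 2) - 1.
  case: andP => [[/eqP-> /eqP->]|neq0].
    by rewrite /x /y /z /= !mul0r subrr cot0 addr0; ring.
  have sinz : sin (j%:R / k%:R * pi - i%:R / h%:R * pi : R) != 0.
    (* Here [p] stands for the absolute value of [j h - i k], the numerator over [h k]. If [h k]
       divides it, coprimality gives [k %| j] and [h %| i], so both indices are 0. *)
    have nz p : (j * h = p + i * k \/ i * k = p + j * h)%N -> ~~ (h * k %| p)%N.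
      move=> pE; apply/negP => dvd_p; apply: neq0.
      have dvd_hp := dvdn_trans (dvdn_mulr k (dvdnn h)) dvd_p.
      have dvd_kp := dvdn_trans (dvdn_mull h (dvdnn k)) dvd_p.
      have [dvd_j dvd_i] : (k %| j * h)%N /\ (h %| i * k)%N.
        case: pE => [E|E]; split.
        + by rewrite E dvdn_add ?dvdn_mull.
        + by rewrite -(dvdn_addr _ dvd_hp) -E dvdn_mull.
        + by rewrite -(dvdn_addr _ dvd_kp) -E dvdn_mull.
        + by rewrite E dvdn_add ?dvdn_mull.
      move: dvd_j dvd_i; rewrite !Gauss_dvdl // => dvd_j dvd_i.
      split; apply/eqP/val_inj => /=; apply/eqP; rewrite -leqn0 leqNgt; apply/negP => gt0.
        by have := dvdn_leq gt0 dvd_j; rewrite leqNgt ltn_ord.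
      by have := dvdn_leq gt0 dvd_i; rewrite leqNgt ltn_ord.
    have hk_gt0 : (0 < h * k)%N by rewrite muln_gt0 h_gt0.
    case: (leqP (i * k) (j * h)) => [le_ij|/ltnW le_ji].
      have -> : j%:R / k%:R * pi - i%:R / h%:R * pi
          = (j * h - i * k)%:R / (h * k)%:R * pi :> R.
        by rewrite natrB // !natrM; field; rewrite h_neq0 k_neq0.
      apply: (sin_ratpi_neq0 _ _ (h * k)) => //; apply: nz.
      by left; rewrite subnK.
    have -> : j%:R / k%:R * pi - i%:R / h%:R * pi
        = - ((i * k - j * h)%:R / (h * k)%:R * pi) :> R.
      by rewrite natrB // !natrM; field; rewrite h_neq0 k_neq0.
    rewrite sinN oppr_eq0; apply: (sin_ratpi_neq0 _ _ (h * k)) => //; apply: nz.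
    by right; rewrite subnK.
  have xyB : w + a%:R / mu%:R * pi + j%:R / k%:R * pi
      - (w + a%:R / mu%:R * pi + i%:R / h%:R * pi)
      = j%:R / k%:R * pi - i%:R / h%:R * pi by ring.
  by rewrite mul0r /x /y cotM ?sinD_ratpi_neq0 ?xyB // -/(z j i); ring.
have xk a : \sum_j x a j = k%:R * f a by apply: sum_cotD.
have yh a : \sum_i y a i = h%:R * g a by apply: sum_cotD.
have xmu j : \sum_a x a j = mu%:R * u j.
  rewrite -sum_cotD //; apply: eq_bigr => a _; rewrite /x addrAC //.
have ymu i : \sum_a y a i = mu%:R * v i.
  rewrite -sum_cotD //; apply: eq_bigr => a _; rewrite /y addrAC //.
(* At [j = 0] a pole occurs, which [sum_cotB] admits; for other [j], [k] does not divide [h * j]. *)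
have zh j : \sum_i z j i = h%:R * cot (h%:R * (j%:R / k%:R * pi)).
  apply: sum_cotB => // j_neq0.
  rewrite !mulrA -natrM; apply: (sin_ratpi_neq0 _ _ k) => //.
  rewrite Gauss_dvdr // gtnNdvd // lt0n.
  by apply: contraNN j_neq0 => /eqP ->; rewrite !mul0r.
have zk i : \sum_j z j i = - (k%:R * cot (k%:R * (i%:R / h%:R * pi))).
  rewrite -sum_cotB //.
    by rewrite -sumrN; apply: eq_bigr => j _; rewrite -cotN opprB.
  move=> i_neq0.
  rewrite !mulrA -natrM; apply: (sin_ratpi_neq0 _ _ h) => //.
  rewrite Gauss_dvdr // gtnNdvd // lt0n.
  by apply: contraNN i_neq0 => /eqP ->; rewrite !mul0r.
have total : \sum_a \sum_j \sum_i (x a j * y a i + x a j * z j i - y a i * z j i)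
   = mu%:R ^+ 2 * csc (mu%:R * w) ^+ 2 - h%:R * k%:R * mu%:R.
  have col a : \sum_j \sum_i (x a j * y a i + x a j * z j i - y a i * z j i)
      = 1 + cot (w + a%:R / mu%:R * pi) ^+ 2 - h%:R * k%:R.
    under eq_bigr => j _ do under eq_bigr => i _ do rewrite xyz.
    rewrite pair_big /= sumrB (bigD1 (O, O')) //= ?eqxx mul1r big1 ?addr0.
      by rewrite sumr_const card_prod !card_ord natrM [k%:R * _]mulrC.
    by case=> j i /=; rewrite xpair_eqE => /negPf ->; rewrite mul0r.
  under eq_bigr => a _ do rewrite col.
  have sin_w : sin (mu%:R * w) != 0.
    by have := sin_mu 0%N; rewrite !mul0r addr0.
  rewrite sumrB big_split /= sum_cot_sqr // !sumr_const card_ord.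
  by rewrite -[_ *+ mu]mulr_natr; ring.
(* Each of the three products separates once its shared index is fixed: [a] here, then [j], then
   [i]. *)
have xy : \sum_a \sum_j \sum_i x a j * y a i
    = h%:R * k%:R * \sum_(a < mu) f a * g a.
  rewrite mulr_sumr; apply: eq_bigr => a _.
  under eq_bigr => j _ do rewrite -mulr_sumr yh.
  by rewrite -mulr_suml xk; ring.
have xz : \sum_a \sum_j \sum_i x a j * z j i
    = h%:R * mu%:R * \sum_(j < k) u j * cot (h%:R * (j%:R / k%:R * pi)).
  rewrite exchange_big mulr_sumr; apply: eq_bigr => j _.
  under eq_bigr => a _ do rewrite -mulr_sumr zh.
  by rewrite -mulr_suml xmu; ring.
have yz : \sum_a \sum_j \sum_i y a i * z j i
    = - (k%:R * mu%:R * \sum_(i < h) v i * cot (k%:R * (i%:R / h%:R * pi))).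
  under eq_bigr => a _ do rewrite exchange_big.
  rewrite exchange_big mulr_sumr -sumrN; apply: eq_bigr => i _.
  under eq_bigr => a _ do rewrite -mulr_sumr zk.
  by rewrite -mulr_suml ymu; ring.
(* The minus sign in [yz] cancels the one in [total], so both cotangent sums enter positively; the
   factors [h mu] and [k mu] are [4 h k mu] times the normalisations [1 / (4 k)] and [1 / (4 h)]. *)
move: total.
under eq_bigr => a _.
  under eq_bigr => j _ do rewrite sumrB big_split /=.
  rewrite sumrB big_split /=; over.
rewrite sumrB big_split /= xy xz yz => <-; field.
by rewrite h_neq0 k_neq0.
Qed.
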